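(* Let $K$ be a field, let $f\ge1$ and $m>0$ be integers. For each $i\in\mathbb Z/f\mathbb Z$ let $M_i$ be a $K$-vector space of dimension $m$, let $\sigma_i,\tau_i\in\mathrm{Aut}(K)$, let $\varphi_i:M_{i-1}\to M_i$ be a $\sigma_i$-linear map and $\psi_i:M_i\to M_{i-1}$ a $\tau_i$-linear map, such that $\varphi_i\circ\psi_i=0$ and $\psi_i\circ\varphi_i=0$ for all $i\in\mathbb Z/f\mathbb Z$. Assume that both of the following conditions hold: (A) the pair $(K,\Xi)$ is $1$-algebraically closed for all automorphisms $\Xi\in\mathrm{Aut}(K)$ of the form $\Xi=\sigma_a\xi_{a-1}\xi_{a-2}\cdots\xi_{a+1}$ for some $a\in\mathbb Z/f\mathbb Z$, where $\xi_{a-i}=\sigma_{a-i}$ or $\xi_{a-i}=\tau_{a-i}^{-1}$ for all $1\le i\le f-1$; (B) the pair $(K,\Xi)$ is $1$-algebraically closed for all automorphisms $\Xi\in\mathrm{Aut}(K)$ of the form $\Xi=\tau_a\xi_{a+1}\xi_{a+2}\cdots\xi_{a-1}$ for some $a\in\mathbb Z/f\mathbb Z$, where $\xi_{a+i}=\tau_{a+i}$ or $\xi_{a+i}=\sigma_{a+i}^{-1}$ for all $1\le i\le f-1$. Then there exists a collection of lines ($1$-dimensional $K$-subspaces) $\ell_i\subseteq M_i$, $i\in\mathbb Z/f\mathbb Z$, such that for all $i\in\mathbb Z/f\mathbb Z$, $$\varphi_i(\ell_{i-1})\subseteq\ell_i,\qquad \psi_i(\ell_i)\subseteq\ell_{i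-1}.$$
   Context: Products of automorphisms denote composition. For a field $K$ and $\sigma\in\mathrm{Aut}(K)$, the skew polynomial ring $K[T;\sigma]$ is the $K$-algebra generated by $T$ with $Tx=\sigma(x)T$ for $x\in K$; its elements are uniquely of the form $\sum_n a_nT^n$ with $a_n\in K$. For $x\in K$, evaluation at $x$ is the (left) $K$-linear form with $T^0\mapsto1$ and $T^n\mapsto x\sigma(x)\cdots\sigma^{n-1}(x)$ for $n>0$; $x$ is a root of $P(T)$ if its evaluation at $x$ is $0$. The pair $(K,\sigma)$ is $1$-algebraically closed if every non-constant skew polynomial $P(T)\in K[T;\sigma]$ has a root in $K$. When $f=1$, conditions (A) and (B) say that $(K,\sigma_0)$ and $(K,\tau_0)$ are $1$-algebraically closed. *)

(* Defs.v *)
From HB Require Import structures.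
From mathcomp Require Import all_boot all_order all_algebra.

Set Implicit Arguments.
Unset Strict Implicit.
Unset Printing Implicit Defensive.

Import GRing.Theory.
Local Open Scope ring_scope.

(* The inverse is a field of the record so that it can be used as a function
   without any choice principle. *)
Record fieldAut (K : fieldType) := FieldAut {
  aut_fun :> {rmorphism K -> K};
  aut_inv : {rmorphism K -> K};
  autK : cancel aut_fun aut_inv;
  autVK : cancel aut_inv aut_fun
}.

Definition aut1 (K : fieldType) : fieldAut K :=
  @FieldAut K idfun idfun (fun=> erefl) (fun=> erefl).

Definition autV (K : fieldType) (s : fieldAut K) : fieldAut K :=
  FieldAut (@autVK K s) (@autK K s).

Definition autM (K : fieldType) (s t : fieldAut K) : fieldAut K :=
  @FieldAut K (s \o t) (aut_inv t \o aut_inv s)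
    (can_comp (@autK K s) (@autK K t)) (can_comp (@autVK K t) (@autVK K s)).

(* K[T; s]: the left K-space is that of {poly K}, a polynomial with coefficients
   a_n standing for the sum of the a_n T^n (coefficients on the left); only the
   product is twisted. *)
Definition skewpoly (K : fieldType) (s : fieldAut K) : Type := {poly K}.

HB.instance Definition _ (K : fieldType) (s : fieldAut K) :=
  GRing.Lmodule.copy (skewpoly s) {poly K}.

Section SkewRing.
Variables (K : fieldType) (s : fieldAut K).
Implicit Types P Q R : {poly K}.

(* Left multiplication by T: T * sum_n a_n T^n = sum_n s(a_n) T^(n+1). *)
Definition skewT P : {poly K} := map_poly s P * 'X.

Definition skew_mul P Q : {poly K} :=
  \sum_(i < size P) P`_i *: iter i skewT Q.

Fact skewTD P Q : skewT (P + Q) = skewT P + skewT Q.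
Proof. by rewrite /skewT rmorphD mulrDl. Qed.

Fact skewTZ a P : skewT (a *: P) = s a *: skewT P.
Proof. by rewrite /skewT map_polyZ scalerAl. Qed.

Fact iter_skewTD i P Q :
  iter i skewT (P + Q) = iter i skewT P + iter i skewT Q.
Proof. by elim: i => //= i ->; rewrite skewTD. Qed.

Fact skew_mul_widen n P Q : (size P <= n)%N ->
  skew_mul P Q = \sum_(i < n) P`_i *: iter i skewT Q.
Proof.
move=> leP; rewrite /skew_mul (big_ord_widen n (fun i => P`_i *: iter i skewT Q)) //.
rewrite big_mkcond; apply: eq_bigr => i _.
by case: ltnP => // le; rewrite nth_default ?scale0r.
Qed.

Fact skew_mulDl : left_distributive skew_mul +%R.
Proof.
move=> P Q R; set n := maxn (size P) (size Q).
rewrite (@skew_mul_widen n (P + Q)) ?size_polyD //.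
rewrite (@skew_mul_widen n P) ?leq_maxl // (@skew_mul_widen n Q) ?leq_maxr //.
by rewrite -big_split; apply: eq_bigr => i _; rewrite coefD scalerDl.
Qed.

Fact skew_mulDr : right_distributive skew_mul +%R.
Proof.
move=> P Q R; rewrite -big_split; apply: eq_bigr => i _.
by rewrite iter_skewTD scalerDr.
Qed.

Fact skew_mul1l : left_id 1 skew_mul.
Proof. by move=> P; rewrite /skew_mul size_poly1 big_ord1 coef1 scale1r. Qed.

Fact skew_mul1r : right_id 1 skew_mul.
Proof.
move=> P; rewrite -[RHS]coefK poly_def; apply: eq_bigr => i _; congr (_ *: _).
by elim: (i : nat) => //= n ->; rewrite /skewT map_polyXn -exprSr.
Qed.

Fact skew_mulZl a P Q : skew_mul (a *: P) Q = a *: skew_mul P Q.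
Proof.
rewrite (@skew_mul_widen (size P)) ?size_scale_leq // scaler_sumr.
by apply: eq_bigr => i _; rewrite coefZ scalerA.
Qed.

Fact skew_mulTl P Q : skew_mul (skewT P) Q = skewT (skew_mul P Q).
Proof.
have le: (size (skewT P) <= (size P).+1)%N.
  by rewrite (leq_trans (size_polyMleq _ _)) // size_polyX addn2 /= size_map_poly.
rewrite (skew_mul_widen _ le) big_ord_recl {1}/skewT coefMX scale0r add0r.
have skewT0 : skewT 0 = 0 by rewrite /skewT rmorph0 mul0r.
rewrite [in RHS]/skew_mul (big_morph skewT skewTD skewT0).
by apply: eq_bigr => i _; rewrite skewTZ {1}/skewT coefMX /= coef_map.
Qed.

Fact skew_mulA : associative skew_mul.
Proof.
move=> P Q R; have mul0 : skew_mul 0 R = 0 by rewrite /skew_mul size_poly0 big_ord0.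
rewrite {2}/skew_mul (big_morph (skew_mul^~ R) (fun p q => skew_mulDl p q R) mul0).
apply: eq_bigr => i _; rewrite skew_mulZl; congr (_ *: _).
by elim: (i : nat) => //= n ->; rewrite skew_mulTl.
Qed.

HB.instance Definition _ := GRing.Zmodule_isNzRing.Build (skewpoly s)
  skew_mulA skew_mul1l skew_mul1r skew_mulDl skew_mulDr (oner_neq0 {poly K}).

Fact skewTx (x : K) :
  ('X : skewpoly s) * (x%:P : skewpoly s) = s x *: ('X : skewpoly s).
Proof.
rewrite /GRing.mul /= /skew_mul size_polyX big_ord_recl big_ord1 !coefX /=.
by rewrite scale0r add0r scale1r /skewT map_polyC /= mul_polyC.
Qed.

(* T^n is sent to x * s(x) * ... * s^(n-1)(x). *)
Definition skew_eval (x : K) (P : skewpoly s) : K :=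
  \sum_(n < size (P : {poly K}))
     (P : {poly K})`_n * \prod_(j < n) iter j s x.

Definition skew_root (P : skewpoly s) (x : K) : Prop := skew_eval x P = 0.

End SkewRing.

Definition one_alg_closed (K : fieldType) (s : fieldAut K) : Prop :=
  forall P : skewpoly s, (1 < size (P : {poly K}))%N ->
    exists x : K, skew_root P x.

(* For i : 'I_f, [ord_pred i] and [ordS i] are i - 1 and i + 1 modulo f. *)

Definition condA (K : fieldType) (f : nat) (sigma tau : 'I_f -> fieldAut K) :
    Prop :=
  forall (a : 'I_f) (xi : 'I_f -> fieldAut K),
    (forall k, (1 <= k < f)%N ->
       let j := iter k (@ord_pred f) a in
       xi j = sigma j \/ xi j = autV (tau j)) ->
    one_alg_closed
      (autM (sigma a)
         (\big[@autM K/aut1 K]_(1 <= k < f) xi (iter k (@ord_pred f) a))).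

Definition condB (K : fieldType) (f : nat) (sigma tau : 'I_f -> fieldAut K) :
    Prop :=
  forall (a : 'I_f) (xi : 'I_f -> fieldAut K),
    (forall k, (1 <= k < f)%N ->
       let j := iter k (@ordS f) a in
       xi j = tau j \/ xi j = autV (sigma j)) ->
    one_alg_closed
      (autM (tau a)
         (\big[@autM K/aut1 K]_(1 <= k < f) xi (iter k (@ordS f) a))).

(* Main.v *)
Require Import Defs.
From mathcomp Require Import all_boot all_order all_algebra.

Set Implicit Arguments.
Unset Strict Implicit.
Unset Printing Implicit Defensive.

Import GRing.Theory VectorInternalTheory.
Local Open Scope ring_scope.

(* Induction on m. If at each i one of phi_i, psi_i is bijective, composing
   these maps or their inverses around the cycle gives a semilinear bijection of
   one of the M_a; it has an eigenvector, because a root x of a minimal skew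
   polynomial relation P(F) v = 0 lets one divide P on the right by T - x.

   Otherwise phi_a and psi_a are both singular for some a. Start from
   U_a = ker psi_a, and let U_i be phi_i(U_{i-1}) if phi_i is injective on
   U_{i-1}, and psi_i^{-1}(U_{i-1}) if not. Neither step decreases the
   dimension, and U_{i-1}, U_i are compatible with phi_i and psi_i. If U_{a-1}
   meets ker phi_a, a common vector can be pulled back along the steps to a
   family of lines. If not, then phi_a embeds U_{a-1} into ker psi_a = U_a, so
   all the U_i have the same dimension d with 0 < d < m and they are stable
   under the phi_i and psi_i: the induction hypothesis applies to them. *)

(** * Semilinear functions *)

Section SemilinearFun.
Variables (K : fieldType) (s : fieldAut K) (U V : lmodType K) (F : U -> V).
Hypothesis F_semilinear : forall c u v, F (c *: u + v) = s c *: F u + F v.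

Lemma semilinearD u v : F (u + v) = F u + F v.
Proof. by rewrite -[u in LHS]scale1r F_semilinear rmorph1 scale1r. Qed.

Lemma semilinear0 : F 0 = 0.
Proof. by apply: (addrI (F 0)); rewrite -semilinearD !addr0. Qed.

Lemma semilinearZ c u : F (c *: u) = s c *: F u.
Proof. by rewrite -[_ *: u]addr0 F_semilinear semilinear0 addr0. Qed.

End SemilinearFun.

(** * Eigenvectors of semilinear endomorphisms *)

Section Eigenvector.
Variables (K : fieldType) (s : fieldAut K) (n : nat).
Variable F : 'rV[K]_n -> 'rV[K]_n.
Hypothesis F_semilinear : forall c u v, F (c *: u + v) = s c *: F u + F v.

Let FD := semilinearD F_semilinear.
Let F0 := semilinear0 F_semilinear.
Let FZ := semilinearZ F_semilinear.

(** The evaluation of T^k at x, that is, the remainder of T^k in right division by T - x. *)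
Definition pnorm (x : K) k := \prod_(j < k) iter j s x.

Lemma pnormS x k : s (pnorm x k) * x = pnorm x k.+1.
Proof. by rewrite /pnorm rmorph_prod big_ord_recl mulrC. Qed.

(* Right division by T - x: T^k = Q_k (T - x) + pnorm x k, and [quo x k i] is
   the coefficient of T^i in Q_k. *)
Fixpoint quo x k i {struct k} : K :=
  if k is k'.+1 then if i is i'.+1 then s (quo x k' i') else s (pnorm x k')
  else 0.

Lemma quo_big x k i : (k <= i)%N -> quo x k i = 0.
Proof. by elim: k i => // k IH [//|i] /IH /= ->; rewrite rmorph0. Qed.

Lemma quo_lead x k : quo x k.+1 k = 1.
Proof.
elim: k => [|k /= IH] /=; first by rewrite /pnorm big_ord0 rmorph1.
by case: k IH => [|k] /= ->; rewrite rmorph1.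
Qed.

(** This is T^k = Q_k (T - x) + pnorm x k with T acting as F. The inductive step multiplies by T on
    the left and uses T b = s(b) (T - x) + s(b) x for b = pnorm x k. *)
Lemma iterF_quo x v k : iter k F v =
  \sum_(i < k) quo x k i *: iter i F (F v - x *: v) + pnorm x k *: v.
Proof.
elim: k => [|k IH]; first by rewrite big_ord0 add0r /pnorm big_ord0 scale1r.
rewrite iterS {}IH FD FZ (big_morph F FD F0) big_ord_recl /=.
under eq_bigr => i _ do rewrite FZ -iterS.
by rewrite -pnormS -scalerA [RHS]addrAC -scalerDr subrK addrC.
Qed.

(** Induction on the degree of P in a relation P(F) v = 0. If x is a root of P, then P = R (T - x),
    so either F v = x v, or F v - x v is a nonzero vector killed by R(F), where R has degree one
    less and the same leading coefficient. *)
Lemma eigenvector_of_relation k c v : v != 0 -> c k != 0 ->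
  one_alg_closed s -> \sum_(i < k.+1) c i *: iter i F v = 0 ->
  exists2 w, w != 0 & exists x, F w = x *: w.
Proof.
elim: k c v => [|k IH] c v v0 ck0 closed.
  by rewrite big_ord1 => /eqP; rewrite scaler_eq0 (negPf v0) (negPf ck0).
move=> rel; pose P : {poly K} := \poly_(i < k.+2) c i.
have szP : size P = k.+2 by apply: size_poly_eq.
have [|x] := closed P; first by rewrite szP.
rewrite /skew_root /skew_eval szP.
under eq_bigr => i _ do rewrite coef_poly ltn_ord.
move=> rootx; have [w0|w0] := eqVneq (F v - x *: v) 0.
  by exists v => //; exists x; apply/eqP; rewrite -subr_eq0 w0.
apply: (IH (fun i => \sum_(j < k.+2) c j * quo x j i) _ w0) => //.
  rewrite big_ord_recr /=; have /= -> := quo_lead x k.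
  rewrite mulr1 big1 ?add0r // => j _.
  by rewrite quo_big ?mulr0 // -ltnS.
apply: etrans rel; under [RHS]eq_bigr => j _ do
  rewrite (iterF_quo x) scalerDr scalerA.
rewrite big_split /= -scaler_suml rootx scale0r addr0.
under [LHS]eq_bigr => i _ do rewrite scaler_suml.
rewrite exchange_big /=; apply: eq_bigr => j _.
rewrite (big_ord_widen k.+1 (fun i => quo x j i *: iter i F (F v - x *: v)));
  last by rewrite -ltnS.
rewrite scaler_sumr [RHS]big_mkcond; apply: eq_bigr => i _ /=.
by case: ltnP => [_|ji]; rewrite ?scalerA // quo_big ?mulr0 ?scale0r.
Qed.

(** In dimension n the vectors v, F v, ..., F^n v are dependent, which gives a relation to start
    from. *)
Lemma semilinear_eigenvector : (0 < n)%N -> one_alg_closed s ->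
  exists2 v, v != 0 & exists x, F v = x *: v.
Proof.
move=> n0 closed; pose v : 'rV[K]_n := const_mx 1.
have v0 : v != 0.
  apply/eqP => /matrixP/(_ 0 (Ordinal n0))/eqP; rewrite !mxE.
  by rewrite (negPf (oner_neq0 K)).
pose B := \matrix_(i < n.+1) iter i F v.
have kerB : kermx B != 0.
  by rewrite -mxrank_eq0 mxrank_ker subn_eq0 -ltnNge ltnS rank_leq_col.
pose r := nz_row (kermx B); have r0 : r != 0 by rewrite nz_row_eq0.
have rB : r *m B = 0 by apply/sub_kermxP; apply: nz_row_sub.
pose c i := if insub i is Some j then r 0 j else 0.
have cE (i : 'I_n.+1) : c i = r 0 i by rewrite /c valK.
have {rB} rel : \sum_(i < n.+1) c i *: iter i F v = 0.
  apply: etrans rB; rewrite mulmx_sum_row; apply: eq_bigr => i _.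
  by rewrite cE rowK.
have [j0 rj0] : exists j, r 0 j != 0 by apply/rV0Pn.
(* The relation is cut off at its last nonzero coefficient, which becomes the leading one. *)
have [j cj0 jmax] := @arg_maxnP _ j0 (fun j => r 0 j != 0) (@nat_of_ord _) rj0.
apply: (@eigenvector_of_relation j c v v0) => //; first by rewrite cE.
apply: etrans rel; rewrite (big_ord_widen n.+1 (fun i => c i *: iter i F v)) //.
rewrite big_mkcond; apply: eq_bigr => i _; case: ltnP => // ij.
rewrite cE; have [->|/jmax] := eqVneq (r 0 i) 0; first by rewrite scale0r.
by move=> /(leq_trans ij); rewrite ltnn.
Qed.

End Eigenvector.

(** * Induction and recursion around a cycle *)

Lemma cyclic_ind (T : finType) (p : T -> T) (a : T) (Pr : T -> Prop) :
    (forall i j, fconnect p i j) -> Pr a ->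
  (forall i, i != a -> Pr (p i) -> Pr i) -> forall i, Pr i.
Proof.
move=> cyc Pa IH i; move: (findex p i a) (iter_findex (cyc i a)) => n.
elim: n i => [|n IHn] i; first by move=> /= ->.
by rewrite iterSr => /IHn Ppi; have [->|/IH] := eqVneq i a; last exact.
Qed.

(** Data travel once around the cycle, against [p], from [x0] at [a] to [p a]. The step at [a] is
    left out: whether the walk closes up there is settled in each use, from the formula for
    [w (p a)]. *)
Lemma cyclic_walk (T : finType) (p : T -> T) (a : T) (S : Type) (x0 : S)
    (step : T -> S -> S) :
    injective p -> (forall i j, fconnect p i j) ->
  exists w : T -> S, [/\ w a = x0,
    forall i, i != a -> w i = step i (w (p i))
    & w (p a) = foldr (fun k => step (iter k p a)) x0 (iota 1 #|T|.-1)].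
Proof.
move=> injp cyc; have ordp i : order p i = #|T|.
  by apply: eq_card => j; rewrite !inE; apply: cyc.
have T0 : (0 < #|T|)%N by rewrite -(ordp a) order_gt0.
(* [w k] is the value at [iter k p a], and [kappa] recovers k. Indices run from 1 to [#|T|], so [a]
   has index [#|T|], where the fold is empty, and not 0. *)
pose w k := foldr (fun k => step (iter k p a)) x0 (iota k (#|T| - k)).
pose kappa j := (findex p (p a) j).+1.
have kappaE k : (0 < k <= #|T|)%N -> kappa (iter k p a) = k.
  by case: k => // k lek; rewrite /kappa iterSr findex_iter ?ordp.
have kappaP j : [/\ (0 < kappa j <= #|T|)%N & iter (kappa j) p a = j].
  rewrite /kappa ltnS -[#|T|](ordp (p a)) findex_max // -?iterSr.
  by rewrite iterSr iter_findex.
move: kappa kappaE kappaP => kappa kappaE kappaP.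
exists (w \o kappa); split=> /=.
- by rewrite -{1}(iter_order injp a) ordp kappaE ?T0 ?leqnn // /w subnn.
- move=> i; have [/andP[k0 lek] Ei] := kappaP i => nia.
  have ltk : (kappa i < #|T|)%N.
    rewrite ltn_neqAle lek andbT; apply: contraNneq nia => Ek.
    by rewrite -Ei Ek -(ordp a) iter_order.
  have -> : p i = iter (kappa i).+1 p a by rewrite -[in LHS]Ei.
  by rewrite kappaE ?ltk // /w -(subnSK ltk) /= Ei.
- by rewrite (kappaE 1) // /w subn1.
Qed.

Lemma fconnect_ordS n (i j : 'I_n) : fconnect (@ordS n) i j.
Proof.
suff <- : iter (n - i + j)%N (@ordS n) i = j by apply: fconnect_iter.
have iterE k : (iter k (@ordS n) i : nat) = ((i + k) %% n)%N.
  elim: k => [|k IH] /=; first by rewrite addn0 modn_small.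
  by rewrite IH -addn1 modnDml addn1 addnS.
by apply: ord_inj; rewrite iterE addnA subnKC ?modnDl ?modn_small // ltnW.
Qed.

Lemma fconnect_ord_pred n (i j : 'I_n) : fconnect (@ord_pred n) i j.
Proof.
rewrite -(eq_fconnect (finv_eq_can (@ordSK n))).
by rewrite (same_fconnect_finv (@ordS_inj n)) fconnect_ordS.
Qed.

(** * Semilinear maps as twisted matrix products *)

Section AutMatrix.
Variables (K : fieldType) (s : fieldAut K).

Lemma map_mx_autVK m n (A : 'M[K]_(m, n)) :
  map_mx s (map_mx (aut_inv s) A) = A.
Proof. by rewrite -map_mx_comp map_mx_id // => x /=; rewrite autVK. Qed.

Lemma sub_map_mx_autV m1 m2 n (A : 'M[K]_(m1, n)) (B : 'M[K]_(m2, n)) :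
  (A <= map_mx (aut_inv s) B)%MS = (map_mx s A <= B)%MS.
Proof. by rewrite -(map_submx s) map_mx_autVK. Qed.

End AutMatrix.

Section SemilinearMap.
Variables (K : fieldType) (s : fieldAut K) (m n : nat) (P : 'M[K]_(m, n)).

(** Vectors are rows. The map acts on each row of [X], so it also sends a matrix standing for its
    row space to one standing for the image. *)
Definition slmap d (X : 'M[K]_(d, m)) : 'M[K]_(d, n) := map_mx s X *m P.

Lemma slmap_mul d e (C : 'M_(e, d)) (X : 'M_(d, m)) :
  slmap (C *m X) = map_mx s C *m slmap X.
Proof. by rewrite /slmap map_mxM mulmxA. Qed.

Lemma slmap_linear d c (X Y : 'M_(d, m)) :
  slmap (c *: X + Y) = s c *: slmap X + slmap Y.
Proof. by rewrite /slmap map_mxD map_mxZ mulmxDl scalemxAl. Qed.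

Lemma slmapS d e (X : 'M_(d, m)) (Y : 'M_(e, m)) :
  (X <= Y)%MS -> (slmap X <= slmap Y)%MS.
Proof. by move=> XY; rewrite submxMr // map_submx. Qed.

Lemma slmap0P d e (X : 'M_(d, m)) (Y : 'M_(e, m)) :
  (X <= Y)%MS -> slmap Y = 0 -> slmap X = 0.
Proof. by move=> /slmapS + Y0; rewrite Y0; apply: submx0null. Qed.

Definition slker : 'M[K]_m := map_mx (aut_inv s) (kermx P).

Lemma sub_slker d (X : 'M_(d, m)) : (X <= slker)%MS = (slmap X == 0).
Proof. by rewrite sub_map_mx_autV sub_kermx. Qed.

Lemma mxrank_slker : \rank slker = (m - \rank P)%N.
Proof. by rewrite mxrank_map mxrank_ker. Qed.

Lemma mxrank_slmap d (X : 'M_(d, m)) :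
  (X :&: slker = 0)%MS -> \rank (slmap X) = \rank X.
Proof.
move=> XK; rewrite -(mxrank_map s X) -[RHS](mxrank_mul_ker _ P).
rewrite -[kermx P](map_mx_autVK s) -map_capmx XK map_mx0 mxrank0 addn0 //.
Qed.

(** The preimage of the row space of [Y]: multiplying by [cokermx Y] tests membership in that
    space. *)
Definition slpre e (Y : 'M_(e, n)) : 'M[K]_m :=
  map_mx (aut_inv s) (kermx (P *m cokermx Y)).

Lemma sub_slpre d e (X : 'M_(d, m)) (Y : 'M_(e, n)) :
  (X <= slpre Y)%MS = (slmap X <= Y)%MS.
Proof. by rewrite sub_map_mx_autV sub_kermx mulmxA -submxE. Qed.

(** The coordinates of [x] on the rows of [slmap U] are untwisted by the inverse of s, because
    [slmap] twists the coefficients of a combination of rows. *)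
Definition slpull d (U : 'M[K]_(d, m)) (x : 'rV[K]_n) : 'rV[K]_m :=
  map_mx (aut_inv s) (x *m pinvmx (slmap U)) *m U.

Lemma slpullK d (U : 'M_(d, m)) x :
  (x <= slmap U)%MS -> slmap (slpull U x) = x.
Proof. by move=> xU; rewrite slmap_mul map_mx_autVK mulmxKpV. Qed.

End SemilinearMap.

(** The quotient by the preimage embeds in the quotient by [Y], and source and target have the same
    dimension. *)
Lemma mxrank_slpre (K : fieldType) (s : fieldAut K) n e (P : 'M[K]_n)
  (Y : 'M_(e, n)) : (\rank Y <= \rank (slpre s P Y))%N.
Proof.
rewrite mxrank_map mxrank_ker leq_subRL; last exact: rank_leq_row.
have := mxrankM_maxr P (cokermx Y); rewrite mxrank_coker.
by rewrite leq_subRL ?rank_leq_col // addnC.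
Qed.


(** * Invariant lines, or a stable family of subspaces of constant dimension *)

Section CyclicRep.
Variables (K : fieldType) (f m : nat) (sigma tau : 'I_f -> fieldAut K).
Variables P Q : 'I_f -> 'M[K]_m.

Notation fwd i := (slmap (sigma i) (P i)).
Notation bwd i := (slmap (tau i) (Q i)).

Definition compatible i d (X Y : 'M[K]_(d, m)) :=
  (fwd i X <= Y)%MS && (bwd i Y <= X)%MS.

Definition invariant_lines (u : 'I_f -> 'rV[K]_m) :=
  (forall i, u i != 0) /\ (forall i, compatible i (u (ord_pred i)) (u i)).

Hypothesis fwdQ : forall i, fwd i (Q i) = 0.
Hypothesis bwdP : forall i, bwd i (P i) = 0.

Lemma fwd_bwd i d (X : 'M_(d, m)) : fwd i (bwd i X) = 0.
Proof. by rewrite slmap_mul fwdQ mulmx0. Qed.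

Lemma bwd_fwd i d (X : 'M_(d, m)) : bwd i (fwd i X) = 0.
Proof. by rewrite slmap_mul bwdP mulmx0. Qed.

Lemma compatible_fwd i d (X : 'M_(d, m)) : compatible i X (fwd i X).
Proof. by rewrite /compatible bwd_fwd sub0mx submx_refl. Qed.

Lemma compatible_bwd i d (Y : 'M_(d, m)) : compatible i (bwd i Y) Y.
Proof. by rewrite /compatible fwd_bwd sub0mx submx_refl. Qed.

(** Here phi_i is onto, and psi_i vanishes on its image. *)
Lemma unit_bwd0 i d (X : 'M_(d, m)) : P i \in unitmx -> bwd i X = 0.
Proof.
move=> uP; rewrite /slmap; have := bwdP i; rewrite /slmap.
move/(canRL (mulKmx _)); rewrite map_unitmx => /(_ uP) ->.
by rewrite !mulmx0.
Qed.

Lemma unit_fwd0 i d (X : 'M_(d, m)) : Q i \in unitmx -> fwd i X = 0.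
Proof.
move=> uQ; rewrite /slmap; have := fwdQ i; rewrite /slmap.
move/(canRL (mulKmx _)); rewrite map_unitmx => /(_ uQ) ->.
by rewrite !mulmx0.
Qed.

Definition push i (U : 'M[K]_m) : 'M[K]_m :=
  if (U :&: slker (sigma i) (P i))%MS == 0 then fwd i U
  else slpre (tau i) (Q i) U.

Lemma compatible_push i U : compatible i U (push i U).
Proof.
rewrite /push; case: ifP => _; first exact: compatible_fwd.
by rewrite /compatible sub_slpre bwd_fwd sub0mx -sub_slpre submx_refl.
Qed.

Lemma mxrank_push i U : (\rank U <= \rank (push i U))%N.
Proof.
rewrite /push; case: ifP => [/eqP /mxrank_slmap -> //|_].
exact: mxrank_slpre.
Qed.

(** A vector of [U] compatible with a given [x] in [push i U]. In the last case psi_i kills [x], so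
    any nonzero vector of [U] killed by phi_i will do. *)
Definition pull i (U : 'M[K]_m) (x : 'rV[K]_m) : 'rV[K]_m :=
  if (U :&: slker (sigma i) (P i))%MS == 0 then slpull (sigma i) (P i) U x
  else if bwd i x != 0 then bwd i x
  else nz_row (U :&: slker (sigma i) (P i))%MS.

Lemma pullP i U x : x != 0 -> (x <= push i U)%MS ->
  [/\ pull i U x != 0, (pull i U x <= U)%MS & compatible i (pull i U x) x].
Proof.
rewrite /push /pull => x0; case: eqP => [_ xU|/eqP K0].
  have fx := slpullK xU; rewrite submxMl /compatible fx submx_refl.
  split=> //; first by apply: contraNneq x0 => pull0;
    rewrite -fx pull0 /slmap map_mx0 mul0mx.
  by rewrite -fx bwd_fwd sub0mx.
rewrite sub_slpre => xU; case: (eqVneq (bwd i x) 0) => [bx0|bx0] /=.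
  have := nz_row_sub (U :&: slker (sigma i) (P i))%MS.
  rewrite sub_capmx sub_slker => /andP[-> /eqP nz_ker].
  by rewrite nz_row_eq0 /compatible nz_ker bx0 !sub0mx.
by split=> //; apply: compatible_bwd.
Qed.

Variable a : 'I_f.

(** The inequality in the second alternative, due to phi_a embedding U_{a-1}, will give d < m when
    [P a] is singular. *)
Lemma lines_or_subrep :
  (exists u, invariant_lines u) \/
  (m - \rank (Q a) <= \rank (P a))%N /\
    exists w : 'I_f -> 'M[K]_m, forall i,
      \rank (w i) = (m - \rank (Q a))%N /\ compatible i (w (ord_pred i)) (w i).
Proof.
have [w [wa wE _]] := cyclic_walk a (slker (tau a) (Q a)) push
  (@ord_pred_inj f) (@fconnect_ord_pred f).
have rk_w i : (\rank (w a) <= \rank (w i))%N.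
  move: i; apply: (cyclic_ind (p := @ord_pred f) (a := a)) => [|//|j ja le_w].
    exact: fconnect_ord_pred.
  by rewrite (wE j ja) (leq_trans le_w) ?mxrank_push.
have bwd_wa : bwd a (w a) = 0 by apply/eqP; rewrite -sub_slker wa.
have [cap0|cap0] := eqVneq (w (ord_pred a) :&: slker (sigma a) (P a))%MS 0.
  have rk_fwd := mxrank_slmap cap0.
  have fwd_sub : (fwd a (w (ord_pred a)) <= w a)%MS.
    by rewrite wa sub_slker bwd_fwd.
  (* The walk from a ends at a - 1, where the dimension is therefore largest; the embedding into U_a
     then forces all dimensions to be equal. *)
  have rk_le i : (\rank (w i) <= \rank (w (ord_pred a)))%N.
    move: i; apply: (cyclic_ind (p := @ordS f) (a := ord_pred a)) => [|//|j ja].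
      exact: fconnect_ordS.
    apply: leq_trans; rewrite (wE (ordS j)); first by rewrite ordSK mxrank_push.
    by apply: contraNneq ja => <-; rewrite ordSK.
  have rk_eq i : \rank (w i) = \rank (w a).
    apply/eqP; rewrite eqn_leq rk_w andbT (leq_trans (rk_le i)) //.
    by rewrite -rk_fwd mxrankS.
  have rk_wa : \rank (w a) = (m - \rank (Q a))%N by rewrite wa mxrank_slker.
  right; split.
    by rewrite -rk_wa -(rk_eq (ord_pred a)) -rk_fwd mxrankM_maxr.
  exists w => i; split; first by rewrite rk_eq.
  have [->|ia] := eqVneq i a; last by rewrite (wE i ia) compatible_push.
  by rewrite /compatible fwd_sub bwd_wa sub0mx.
pose u0 := nz_row (w (ord_pred a) :&: slker (sigma a) (P a))%MS.
have := nz_row_sub (w (ord_pred a) :&: slker (sigma a) (P a))%MS.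
rewrite sub_capmx sub_slker -/u0 => /andP[u0w /eqP fwd_u0].
have u00 : u0 != 0 by rewrite nz_row_eq0.
(* The second walk runs backwards, from a - 1 down to a, choosing a vector in each U_j. *)
have [u [ub uE _]] := cyclic_walk (ord_pred a) u0
  (fun j => pull (ordS j) (w j)) (@ordS_inj f) (@fconnect_ordS f).
have uP i : u i != 0 /\ (u i <= w i)%MS.
  move: i; apply: (cyclic_ind (p := @ordS f) (a := ord_pred a)) =>
    [||j ja [uj0 ujw]].
  - exact: fconnect_ordS.
  - by rewrite ub.
  have up : (u (ordS j) <= push (ordS j) (w j))%MS.
    rewrite -[in w j](ordSK j) -wE //.
    by apply: contraNneq ja => <-; rewrite ordSK.
  by rewrite (uE j ja); have [-> ->] := pullP uj0 up.
left; exists u; split=> [i|i]; first by have [] := uP i.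
(* The cycle closes at a because phi_a kills [u0] and psi_a kills all of U_a. *)
have [->|ia] := eqVneq i a.
  rewrite /compatible ub fwd_u0 sub0mx (slmap0P _ bwd_wa) ?sub0mx //.
  by have [] := uP a.
have pia : ord_pred i != ord_pred a by rewrite (inj_eq (@ord_pred_inj f)).
rewrite (uE _ pia) ord_predK; have [ui0 uiw] := uP i.
by have [] := @pullP i (w (ord_pred i)) _ ui0; rewrite -?wE.
Qed.

End CyclicRep.

(** * Going around the cycle by semilinear bijections *)

Lemma foldr_semilinear (K : fieldType) (V : lmodType K)
    (xi : nat -> fieldAut K) (g : nat -> V -> V) (r : seq nat) :
    (forall k c u v, k \in r -> g k (c *: u + v) = xi k c *: g k u + g k v) ->
  forall c u v, foldr g (c *: u + v) r =
    (\big[@autM K/aut1 K]_(k <- r) xi k) c *: foldr g u r + foldr g v r.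
Proof.
elim: r => [|k r IH] g_lin c u v; first by rewrite big_nil.
rewrite big_cons /= IH => [|j d x y jr]; last first.
  by rewrite g_lin // inE jr orbT.
by rewrite g_lin ?mem_head.
Qed.

Section Bijective.
Variables (K : fieldType) (f m : nat) (sigma tau : 'I_f -> fieldAut K).
Variables P Q : 'I_f -> 'M[K]_m.
Hypothesis fwdQ : forall i, slmap (sigma i) (P i) (Q i) = 0.
Hypothesis bwdP : forall i, slmap (tau i) (Q i) (P i) = 0.
Hypothesis m_gt0 : (0 < m)%N.

Notation fwd i := (slmap (sigma i) (P i)).
Notation bwd i := (slmap (tau i) (Q i)).

(** Go from M_{i-1} to M_i by phi_i if it is bijective, by the inverse of psi_i if not. The last map
    is phi_a, so the composite on M_a has an automorphism of the form in (A), and an eigenvector of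
    it spreads to the other spaces. *)
Lemma lines_of_fwd_unit a : condA sigma tau -> P a \in unitmx ->
    (forall i, (P i \in unitmx) || (Q i \in unitmx)) ->
  exists u, invariant_lines sigma tau P Q u.
Proof.
move=> hA Pa unitPQ.
pose xi i := if P i \in unitmx then sigma i else autV (tau i).
pose g i (x : 'rV[K]_m) : 'rV[K]_m := if P i \in unitmx then fwd i x
  else map_mx (aut_inv (tau i)) (x *m invmx (Q i)).
have g_lin i c x y : g i (c *: x + y) = xi i c *: g i x + g i y.
  rewrite /g /xi; case: ifP => _; first exact: slmap_linear.
  by rewrite mulmxDl -scalemxAl map_mxD map_mxZ.
have gC i x : compatible sigma tau P Q i x (g i x).
  rewrite /g; have := unitPQ i; case: ifP => /= [_ _|_ Qi].
    exact: compatible_fwd.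
  rewrite -{1}[x](_ : bwd i (map_mx (aut_inv (tau i)) (x *m invmx (Q i))) = x).
    exact: compatible_bwd.
  by rewrite /slmap map_mx_autVK mulmxKV.
have g_neq0 i x : x != 0 -> g i x != 0.
  rewrite /g; have := unitPQ i; case: ifP => /= [Pi _|_ Qi]; apply: contraNneq.
    rewrite /slmap => /(canRL (mulmxK Pi)); rewrite mul0mx => /eqP.
    by rewrite map_mx_eq0.
  move/eqP; rewrite map_mx_eq0 => /eqP /(canRL (mulmxKV Qi)).
  by rewrite mul0mx => ->.
pose F x := fwd a (foldr (fun k => g (iter k (@ord_pred f) a)) x (iota 1 f.-1)).
have F_lin := @foldr_semilinear K _ (fun k => xi (iter k (@ord_pred f) a))
  (fun k => g (iter k (@ord_pred f) a)) (iota 1 f.-1)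
  (fun k c u v _ => g_lin _ c u v).
have [||v v0 [x Fv]] := @semilinear_eigenvector K
  (autM (sigma a) (\big[@autM K/aut1 K]_(1 <= k < f) xi (iter k (@ord_pred f) a)))
  m F _ m_gt0.
- by move=> c y z; rewrite /F F_lin slmap_linear /index_iota subn1.
- by apply: hA => k _ /=; rewrite /xi; case: ifP; [left | right].
have [u [ua uE upa]] := cyclic_walk a v g
  (@ord_pred_inj f) (@fconnect_ord_pred f).
exists u; split=> i.
  move: i; apply: (cyclic_ind (p := @ord_pred f) (a := a)) => [||i ia].
  - exact: fconnect_ord_pred.
  - by rewrite ua.
  - by rewrite (uE i ia); apply: g_neq0.
have [->|ia] := eqVneq i a; last by rewrite (uE i ia).
rewrite /compatible (unit_bwd0 bwdP) // sub0mx andbT ua upa card_ord.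
by apply/sub_rVP; exists x.
Qed.

Lemma lines_of_bwd_unit (a : 'I_f) : condB sigma tau ->
    (forall i, Q i \in unitmx) ->
  exists u, invariant_lines sigma tau P Q u.
Proof.
move=> hB unitQ; pose g i (x : 'rV[K]_m) : 'rV[K]_m := bwd i x.
have g_neq0 i x : x != 0 -> g i x != 0.
  apply: contraNneq; rewrite /g /slmap => /(canRL (mulmxK (unitQ i))).
  by rewrite mul0mx => /eqP; rewrite map_mx_eq0.
pose F x := g a (foldr (fun k => g (iter k (@ordS f) a)) x (iota 1 f.-1)).
have F_lin := @foldr_semilinear K _ (fun k => tau (iter k (@ordS f) a))
  (fun k => g (iter k (@ordS f) a)) (iota 1 f.-1)
  (fun k c u v _ => slmap_linear _ _ c u v).
have [||v v0 [x Fv]] := @semilinear_eigenvector K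
  (autM (tau a) (\big[@autM K/aut1 K]_(1 <= k < f) tau (iter k (@ordS f) a)))
  m F _ m_gt0.
- by move=> c y z; rewrite /F F_lin /g slmap_linear /index_iota subn1.
- by apply: hB => k _ /=; left.
have [u [ua uE uSa]] := cyclic_walk a v g
  (@ordS_inj f) (@fconnect_ordS f).
(* The walk applies psi_i at step i, so [u i] is a vector of M_{i-1}; hence the shift. *)
exists (fun j => u (ordS j)); split=> i.
  move: (ordS i); apply: (cyclic_ind (p := @ordS f) (a := a)) => [||j ja].
  - exact: fconnect_ordS.
  - by rewrite ua.
  - by rewrite (uE j ja); apply: g_neq0.
rewrite ord_predK; have [->|ia] := eqVneq i a; last first.
  by rewrite (uE i ia); apply: compatible_bwd.
rewrite /compatible (unit_fwd0 fwdQ) // sub0mx ua uSa card_ord.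
by apply/sub_rVP; exists x.
Qed.

End Bijective.

(** * Induction on the dimension *)

Lemma row_base_of_rank (K : fieldType) m n d (A : 'M[K]_(m, n)) :
  \rank A = d -> {B : 'M[K]_(d, n) | row_free B & (B :=: A)%MS}.
Proof.
by move=> <-; exists (row_base A); [apply: row_base_free | apply: eq_row_base].
Qed.

Lemma invariant_lines_exist (K : fieldType) (f m : nat)
    (sigma tau : 'I_f -> fieldAut K) (P Q : 'I_f -> 'M[K]_m) :
    (0 < f)%N -> (0 < m)%N -> condA sigma tau -> condB sigma tau ->
    (forall i, slmap (sigma i) (P i) (Q i) = 0) ->
    (forall i, slmap (tau i) (Q i) (P i) = 0) ->
  exists u, invariant_lines sigma tau P Q u.
Proof.
move=> f0 + hA hB; elim/ltn_ind: m P Q => m IH P Q m0 fwdQ bwdP.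
have [/forallP unitPQ|] := boolP [forall i, (P i \in unitmx) || (Q i \in unitmx)].
  have [a Pa|noP] := pickP (fun i => P i \in unitmx).
    exact: (lines_of_fwd_unit fwdQ bwdP m0 hA Pa).
  apply: (lines_of_bwd_unit fwdQ m0 (Ordinal f0) hB) => i.
  by have := unitPQ i; rewrite noP.
rewrite negb_forall => /existsP[a]; rewrite negb_or => /andP[Pa Qa].
have [//|[le_d [w wP]]] := lines_or_subrep fwdQ bwdP a.
set d := (m - \rank (Q a))%N in le_d wP.
(* Singularity of [Q a] gives 0 < d, that of [P a] gives d < m. *)
have d0 : (0 < d)%N.
  rewrite subn_gt0 ltn_neqAle rank_leq_row andbT.
  by apply: contraNneq Qa => rkQ; rewrite -row_free_unit /row_free rkQ.
have dm : (d < m)%N.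
  apply: leq_ltn_trans le_d _; rewrite ltn_neqAle rank_leq_row andbT.
  by apply: contraNneq Pa => rkP; rewrite -row_free_unit /row_free rkP.
pose B i := s2val (row_base_of_rank (wP i).1).
have freeB i : row_free (B i) := s2valP (row_base_of_rank (wP i).1).
have Bw i : (B i :=: w i)%MS := s2valP' (row_base_of_rank (wP i).1).
(* The matrices of phi_i and psi_i restricted to the stable subspaces, in the bases [B i], which all
   have d rows. *)
pose P' i := slmap (sigma i) (P i) (B (ord_pred i)) *m pinvmx (B i).
pose Q' i := slmap (tau i) (Q i) (B i) *m pinvmx (B (ord_pred i)).
have P'B i : P' i *m B i = slmap (sigma i) (P i) (B (ord_pred i)).
  have [_ /andP[fwd_w _]] := wP i; rewrite mulmxKpV // Bw.
  by apply: submx_trans fwd_w; rewrite slmapS // Bw.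
have Q'B i : Q' i *m B (ord_pred i) = slmap (tau i) (Q i) (B i).
  have [_ /andP[_ bwd_w]] := wP i; rewrite mulmxKpV // Bw.
  by apply: submx_trans bwd_w; rewrite slmapS // Bw.
have fwdB i e (x : 'M_(e, d)) :
    slmap (sigma i) (P' i) x *m B i = slmap (sigma i) (P i) (x *m B (ord_pred i)).
  by rewrite slmap_mul -mulmxA P'B.
have bwdB i e (x : 'M_(e, d)) :
    slmap (tau i) (Q' i) x *m B (ord_pred i) = slmap (tau i) (Q i) (x *m B i).
  by rewrite slmap_mul -mulmxA Q'B.
have [i|i|u [u0 uC]] := IH d dm P' Q' d0.
- by apply: (row_free_inj (freeB i)); rewrite mul0mx fwdB Q'B fwd_bwd.
- apply: (row_free_inj (freeB (ord_pred i))).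
  by rewrite mul0mx bwdB P'B bwd_fwd.
exists (fun i => u i *m B i); split=> i.
  apply: contraNneq (u0 i) => uB0.
  by apply/eqP/(row_free_inj (freeB i)); rewrite uB0 mul0mx.
have /andP[fwd_u bwd_u] := uC i.
by rewrite /compatible -fwdB -bwdB !submxMr.
Qed.

(** * Passage between the spaces M_i and coordinates *)

Lemma coordinates (K : fieldType) (V : vectType K) (m : nat) :
    \dim (fullv : {vspace V}) = m ->
  {h : {linear V -> 'rV[K]_m} & {h' : {linear 'rV[K]_m -> V}
    | cancel h h' & cancel h' h}}.
Proof.
rewrite dimvf => <-; exists (v2r : {linear V -> 'rV[K]_(dim V)}).
exists (r2v : {linear 'rV[K]_(dim V) -> V}); [exact: v2rK | exact: r2vK].
Qed.

Lemma semilinear_matrix (K : fieldType) (s : fieldAut K) m n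
    (F : 'rV[K]_m -> 'rV[K]_n) :
    (forall c u v, F (c *: u + v) = s c *: F u + F v) ->
  forall v, F v = slmap s (\matrix_i F (delta_mx 0 i)) v.
Proof.
move=> F_lin v; rewrite /slmap mulmx_sum_row {1}[v]row_sum_delta 
  (big_morph F (semilinearD F_lin) (semilinear0 F_lin)).
apply: eq_bigr => i _; rewrite rowK mxE.
by rewrite (semilinearZ F_lin).
Qed.

Theorem theorem5p4 (K : fieldType) (f m : nat) (hf : (1 <= f)%N) (hm : (0 < m)%N)
  (M : 'I_f -> vectType K)
  (dimM : forall i : 'I_f, \dim (fullv : {vspace M i}) = m)
  (sigma tau : 'I_f -> fieldAut K)
  (phi : forall i : 'I_f, {linear M (ord_pred i) -> M i | sigma i \; *:%R})
  (psi : forall i : 'I_f, {linear M i -> M (ord_pred i) | tau i \; *:%R})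
  (phi_psi : forall (i : 'I_f) (v : M i), phi i (psi i v) = 0)
  (psi_phi : forall (i : 'I_f) (v : M (ord_pred i)), psi i (phi i v) = 0)
  (hA : condA sigma tau) (hB : condB sigma tau) :
  exists l : forall i : 'I_f, {vspace M i},
    (forall i : 'I_f, \dim (l i) = 1%N) /\
    (forall i : 'I_f,
       (forall v : M (ord_pred i), v \in l (ord_pred i) -> phi i v \in l i) /\
       (forall v : M i, v \in l i -> psi i v \in l (ord_pred i))).
Proof.
pose h i := projT1 (coordinates (dimM i)).
pose h' i := s2val (projT2 (coordinates (dimM i))).
have hK i : cancel (h i) (h' i) := s2valP (projT2 (coordinates (dimM i))).
have h'K i : cancel (h' i) (h i) := s2valP' (projT2 (coordinates (dimM i))).
pose F i x := h i (phi i (h' (ord_pred i) x)).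
pose G i x := h (ord_pred i) (psi i (h' i x)).
pose P i := \matrix_j F i (delta_mx 0 j).
pose Q i := \matrix_j G i (delta_mx 0 j).
have FE i x : F i x = slmap (sigma i) (P i) x.
  by apply: semilinear_matrix => c u v; rewrite /F !linearP.
have GE i x : G i x = slmap (tau i) (Q i) x.
  by apply: semilinear_matrix => c u v; rewrite /G !linearP.
have slmap_row s (A B : 'M[K]_m) :
    (forall i, slmap s A (row i B) = 0) -> slmap s A B = 0.
  move=> AB; apply/row_matrixP => i; rewrite row0 -(AB i).
  by rewrite /slmap row_mul map_row.
have [||u [u0 uC]] := invariant_lines_exist (P := P) (Q := Q) hf hm hA hB.
(* The rows of [Q i] are the images of the basis vectors under psi_i, so phi_i psi_i = 0 is checked
   row by row. *)
- move=> i; apply: slmap_row => j.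
  by rewrite rowK -FE /F /G hK phi_psi linear0.
- move=> i; apply: slmap_row => j.
  by rewrite rowK -GE /F /G hK psi_phi linear0.
exists (fun i => <[h' i (u i)]>%VS); split=> i.
  rewrite dim_vline; case: eqP => // /(congr1 (h i)).
  by rewrite h'K linear0 => /eqP; rewrite (negPf (u0 i)).
have /andP[/sub_rVP[c fwd_u] /sub_rVP[d bwd_u]] := uC i.
split=> v /vlineP[k ->]; rewrite linearZ /= memvZ //; apply/vlineP.
  by exists c; rewrite -[LHS](hK i) -/(F i _) FE fwd_u linearZ.
by exists d; rewrite -[LHS](hK (ord_pred i)) -/(G i _) GE bwd_u linearZ.
Qed.
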